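(* Let $F$ be a finite field and let $n=|F|-1$. Let $A(H)$ be the $(n+2)^2\times(n+2)^2$ adjacency matrix and $T$ the $(n+2)^2\times (n+2)^2$ diagonal $0/1$ matrix defined in the context. Let $\alpha_1\ge\alpha_2\ge\cdots\ge\alpha_{(n+2)^2}$ be the eigenvalues (with multiplicity) of the real symmetric matrix $T+A(H)$. Then: (1) $n+1\le \alpha_1\le 2n+4$. (2) $n+1\le \alpha_i\le n+2$ for all $i=2,3,\dots,n+1$. (3) $1\le \alpha_{n+2}\le n+1$. (4) $1\le \alpha_i\le 2$ for all $i=n+3,\dots,2n+2$. (5) $\alpha_i=1$ for all $i=2n+3,\dots,n+1+\frac{n(n+1)}{2}$. (6) $-1\le \alpha_{n+2+\frac{n(n+1)}{2}}\le 1$. (7) $-1\le \alpha_i\le 0$ for all $i=n+3+\frac{n(n+1)}{2},\dots,2n+3+\frac{n(n+1)}{2}$. (8) $\alpha_i=-1$ for all $i=2n+4+\frac{n(n+1)}{2},\dots,(n+2)^2-n-1$. (9) $-(n+1)\le \alpha_i\le -n$ for all $i=(n+2)^2-n,\dots,(n+2)^2-1$. (10) $\alpha_{(n+2)^2}=-(n+1)$. (A range of indices whose lower end exceeds its upper end is empty.)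
   Context: Let $Z(M_2(F))$ be the set of nonzero zero-divisors of the ring $M_2(F)$ of $2\times 2$ matrices over $F$. Put $N=\begin{bmatrix}0&1\\0&0\end{bmatrix}$, $M=\begin{bmatrix}0&0\\1&0\end{bmatrix}$, and $N_k=\begin{bmatrix}1&k\\-1/k&-1\end{bmatrix}$ for $k\in F\setminus\{0\}$. Let $\mathcal V$ be the set consisting of all idempotents in $Z(M_2(F))$ together with the nilpotent matrices $N$, $M$ and $N_k$ ($k\in F\setminus\{0\}$); it has $(n+2)^2$ elements. $H$ is the graph on $\mathcal V$ in which $x,y\in\mathcal V$ are adjacent if and only if $xy=0$ or $yx=0$, the case $x=y$ being allowed, so the nilpotent vertices $M,N,N_k$ carry loops. $A(H)$ is the matrix indexed by $\mathcal V\times\mathcal V$ whose $(x,y)$ entry is $1$ if $xy=0$ or $yx=0$, and $0$ otherwise (so the diagonal entry is $1$ at $M,N,N_k$ and $0$ at idempotents). $T$ is the diagonal matrix indexed by $\mathcal V$ whose diagonal entry is $1$ at each $N_k$, $k\in F\setminus\{0\}$, and $0$ at all other vertices (in particular $0$ at $M$ and $N$). *)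

(* Defs.v *)
From HB Require Import structures.
From mathcomp Require Import all_boot all_order all_fingroup all_algebra.
From mathcomp Require Import spectral sesquilinear complex ring zify.
From mathcomp Require Export reals.

Set Implicit Arguments.
Unset Strict Implicit.
Unset Printing Implicit Defensive.

Import Order.TTheory GRing.Theory Num.Theory.
Local Open Scope ring_scope.

Section Vertices.
Variable F : finFieldType.

Definition mx2 (a b c d : F) : 'M[F]_2 :=
  \matrix_(i, j) if i == 0 then if j == 0 then a else b
                 else if j == 0 then c else d.

Definition zero_divisors : {set 'M[F]_2} :=
  [set x | (x != 0) &&
           [exists y : 'M[F]_2, (y != 0) && ((x * y == 0) || (y * x == 0))]].

Definition nilN : 'M[F]_2 := mx2 0 1 0 0.
Definition nilM : 'M[F]_2 := mx2 0 0 1 0.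
Definition nilNk (k : F) : 'M[F]_2 := mx2 1 k (- k^-1) (- 1).

Definition nilNks : {set 'M[F]_2} := [set nilNk k | k in [pred k : F | k != 0]].

Definition vertices : {set 'M[F]_2} :=
  [set e in zero_divisors | e * e == e] :|: [set nilN; nilM] :|: nilNks.

(* No condition x != y: a nilpotent vertex is adjacent to itself. *)
Definition adjH : rel 'M[F]_2 := fun x y => (x * y == 0) || (y * x == 0).

(* Matrices indexed by the vertices are indexed by 'I_#|vertices| through the
   enumeration enum_val. *)
Definition adjmx (R : nzRingType) : 'M[R]_#|vertices| :=
  \matrix_(i, j) (adjH (enum_val i) (enum_val j))%:R.

Definition Tmx (R : nzRingType) : 'M[R]_#|vertices| :=
  \matrix_(i, j) ((i == j) && (enum_val i \in nilNks))%:R.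

End Vertices.

(* alpha lists the eigenvalues of A with (algebraic) multiplicity, in
   nonincreasing order. *)
Definition is_spectrum (R : numDomainType) (m : nat) (A : 'M[R]_m)
    (alpha : seq R) : Prop :=
  sorted >=%R alpha /\ char_poly A = \prod_(a <- alpha) ('X - a%:P).


(* is_spectrum is satisfiable: every real symmetric matrix has a
   spectrum in this sense. *)
Lemma spectrum_exists (R : realType) (m : nat) (A : 'M[R]_m) :
  A^T = A -> exists alpha : seq R, is_spectrum A alpha.
Proof.
move=> symA; pose f := real_complex R; pose B : 'M[R[i]]_m := map_mx f A.
have Bh : B \is hermsymmx.
  apply/is_hermitianmxP; rewrite expr0 scale1r; apply/matrixP=> i j.
  rewrite !mxE -[in RHS]symA mxE; exact/esym/conjc_real.
have /orthomx_spectralP := hermitian_normalmx Bh.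
set P := spectralmx B; set sp := spectral_diag B => eqB.
have Pu : P \in unitmx by apply: spectral_unit.
have /mxOverP spr := hermitian_spectral_diag_real Bh.
pose al i := complex.Re (sp 0 i).
have alE i : f (al i) = sp 0 i by exact: RRe_real (spr 0 i).
pose s := sort >=%R [seq al i | i <- enum 'I_m].
exists s; split; first by apply: sort_sorted => x y; exact: le_total.
apply: (@map_poly_inj _ _ f); rewrite map_char_poly -/B.
rewrite (perm_big _ (permEl (perm_sort _ _))) big_map big_enum /= rmorph_prod /=.
have -> : char_poly B = char_poly (diag_mx sp).
  rewrite /char_poly /char_poly_mx {1}eqB !map_mxM.
  have Pu' : map_mx polyC P \in unitmx by rewrite map_unitmx.
  rewrite map_invmx.
  set Q := map_mx _ P; set D := map_mx _ (diag_mx _).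
  have -> : 'X%:M - invmx Q *m D *m Q = invmx Q *m ('X%:M - D) *m Q.
    by rewrite mulmxBr mulmxBl scalar_mxC mulmxKV.
  by rewrite !det_mulmx mulrC mulrA det_inv mulrV ?mul1r // -unitmxE.
rewrite char_poly_trig; last exact: diag_mx_is_trig.
apply: eq_bigr => i _; rewrite rmorphB /= map_polyX map_polyC /=.
by rewrite -[real_complex_def _ _]/(f (al i)) alE mxE eqxx mulr1n.
Qed.

Lemma symmetric_TA (F : finFieldType) (R : realType) :
  (Tmx F R + adjmx F R)^T = Tmx F R + adjmx F R.
Proof.
apply/matrixP=> i j; rewrite !mxE /adjH orbC; congr (_%:R + _).
by rewrite eq_sym; case: eqP => // ->.
Qed.

Section CardVertices.
Variable F : finFieldType.
Implicit Types (a b c d k : F) (x y : 'M[F]_2).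

Lemma mx2K x : mx2 (x 0 0) (x 0 1) (x 1 0) (x 1 1) = x.
Proof.
by apply/matrixP=> i j; rewrite mxE; case: i => -[|[|//]] i /=;
  case: j => -[|[|//]] j /=; congr (x _ _); apply: val_inj.
Qed.

Lemma mx2_inj a b c d a' b' c' d' :
  mx2 a b c d = mx2 a' b' c' d' -> [/\ a = a', b = b', c = c' & d = d'].
Proof.
move/matrixP=> e; split; [have := e 0 0 | have := e 0 1 | have := e 1 0
  | have := e 1 1]; by rewrite !mxE.
Qed.

Lemma mul_mx2 a b c d a' b' c' d' :
  mx2 a b c d * mx2 a' b' c' d' =
  mx2 (a * a' + b * c') (a * b' + b * d') (c * a' + d * c') (c * b' + d * d').
Proof.
apply/matrixP=> i j; rewrite !mxE big_ord_recl big_ord1 !mxE /=.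
by case: (i == 0); case: (j == 0).
Qed.

Lemma mx2_0 : mx2 0 0 0 0 = 0 :> 'M[F]_2.
Proof. by apply/matrixP=> i j; rewrite !mxE; do 2!case: ifP. Qed.

Lemma mx2_1 : mx2 1 0 0 1 = 1 :> 'M[F]_2.
Proof. by rewrite -[RHS]mx2K !mxE. Qed.

Let idem1 (p : F * F) : 'M[F]_2 :=
  mx2 p.1 p.2 (p.1 * (1 - p.1) / p.2) (1 - p.1).
Let idem2 c : 'M[F]_2 := mx2 1 0 c 0.
Let idem3 c : 'M[F]_2 := mx2 0 0 c 1.
Let I1 := idem1 @: setX setT [set~ 0].
Let I2 := idem2 @: setT.
Let I3 := idem3 @: setT.

Lemma idem_zero_divisor x : x != 0 -> x != 1 -> x * x = x -> x \in zero_divisors F.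
Proof.
move=> x0 x1 xx; rewrite inE x0; apply/existsP; exists (1 - x).
by rewrite subr_eq0 eq_sym x1 mulrBr mulr1 xx subrr eqxx.
Qed.

Lemma one_not_zero_divisor : 1 \notin zero_divisors F.
Proof.
rewrite inE oner_eq0 /=; apply/existsP=> -[y /andP[y0]].
by rewrite mul1r mulr1 orbb (negPf y0).
Qed.

Lemma idempotents_eq :
  [set e in zero_divisors F | e * e == e] = I1 :|: I2 :|: I3.
Proof.
apply/setP=> x; rewrite in_set !in_setU; apply/idP/idP.
  case/andP=> zx /eqP; have x0 : x != 0 by move: zx; rewrite inE; case/andP.
  have x1 : x != 1 by apply: contraNneq one_not_zero_divisor => <-.
  move: x0 x1; rewrite -[x]mx2K; move: (x 0 0) (x 0 1) (x 1 0) (x 1 1).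
  move=> a b c d x0 x1; rewrite mul_mx2 => /mx2_inj[ea eb ec ed].
  have [b0|b0] := eqVneq b 0; last first.
    suff -> : mx2 a b c d = idem1 (a, b).
      by rewrite /I1 imset_f // !inE.
    have ed' : d = 1 - a by apply: (mulIf b0); rewrite mulrBl mul1r -{2}eb; ring.
    rewrite /idem1 /=; congr mx2 => //.
    by apply: (mulIf b0); rewrite mulfVK // [RHS]mulrBr mulr1 -{1}ea; ring.
  subst b; rewrite !(mul0r, mulr0, addr0, add0r) in ea ec ed eb.
  have /orP[/eqP a0|/eqP a1] : (a == 0) || (a == 1).
  - by rewrite -[a == 1]subr_eq0 -mulf_eq0 mulrBr mulr1 ea subrr.
  - have /orP[/eqP d0|/eqP d1] : (d == 0) || (d == 1).
    + by rewrite -[d == 1]subr_eq0 -mulf_eq0 mulrBr mulr1 ed subrr.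
    + move: x0; rewrite a0 d0 in ec *; rewrite mulr0 mul0r addr0 in ec.
      by rewrite -ec mx2_0 eqxx.
    + by rewrite a0 d1 [_ \in I3]imset_f ?orbT // inE.
  - have /orP[/eqP d0|/eqP d1] : (d == 0) || (d == 1).
    + by rewrite -[d == 1]subr_eq0 -mulf_eq0 mulrBr mulr1 ed subrr.
    + by rewrite a1 d0 [_ \in I2]imset_f ?orbT // inE.
    + move: x1; rewrite a1 d1 in ec *; rewrite mulr1 mul1r in ec.
      have -> : c = 0 by apply: (addrI c); rewrite ec addr0.
      by rewrite mx2_1 eqxx.
move=> xI; suff [xx x0 x1] : [/\ x * x = x, x != 0 & x != 1].
  by rewrite xx eqxx andbT; apply: idem_zero_divisor.
have o0 := oner_neq0 F.
case/orP: xI => [/orP[]|] /imsetP[].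
- case=> a b; rewrite !inE /= => b0 ->; rewrite -mx2_0 -mx2_1; split.
  + by rewrite mul_mx2 /=; congr mx2 => /=; field.
  + by apply/eqP=> /mx2_inj[_ /= e _ _]; rewrite e eqxx in b0.
  + by apply/eqP=> /mx2_inj[_ /= e _ _]; rewrite e eqxx in b0.
- move=> c _ ->; rewrite -mx2_0 -mx2_1; split.
  + by rewrite mul_mx2; congr mx2; ring.
  + by apply/eqP=> /mx2_inj[e _ _ _]; rewrite e eqxx in o0.
  + by apply/eqP=> /mx2_inj[_ _ _ e]; rewrite -e eqxx in o0.
- move=> c _ ->; rewrite -mx2_0 -mx2_1; split.
  + by rewrite mul_mx2; congr mx2; ring.
  + by apply/eqP=> /mx2_inj[_ _ _ e]; rewrite e eqxx in o0.
  + by apply/eqP=> /mx2_inj[e _ _ _]; rewrite -e eqxx in o0.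
Qed.

Lemma card_setU_disjoint (T : finType) (A B : {set T}) :
  (forall t, t \in A -> t \in B -> False) -> #|A :|: B| = (#|A| + #|B|)%N.
Proof.
move=> dAB; rewrite cardsU (_ : A :&: B = set0) ?cards0 ?subn0 //.
by apply/setP=> t; rewrite !inE; apply/negP=> /andP[tA tB]; apply: (dAB t).
Qed.

Lemma card_vertices (n : nat) :
  n = (#|F| - 1)%N -> #|vertices F| = ((n + 2) ^ 2)%N.
Proof.
move=> hn; have q1 : #|F| = n.+1.
  by rewrite hn subn1 prednK //; apply/card_gt0P; exists 0.
have qx : #|[set~ (0 : F)]| = n by rewrite cardsC1 q1.
have o0 := oner_neq0 F.
have c1 : #|I1| = (n.+1 * n)%N.
  rewrite card_in_imset ?cardsX ?cardsT ?q1 ?qx //.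
  by move=> [a b] [a' b'] _ _ /mx2_inj[/= -> -> _ _].
have c2 : #|I2| = n.+1.
  by rewrite card_imset ?cardsT ?q1 // => c c' /mx2_inj[].
have c3 : #|I3| = n.+1.
  by rewrite card_imset ?cardsT ?q1 // => c c' /mx2_inj[].
have c5 : #|nilNks F| = n.
  rewrite -qx /nilNks card_imset => [|k k' /mx2_inj[]//].
  by apply: eq_card => k; rewrite !inE.
have tr1 x : x \in I1 :|: I2 :|: I3 -> x 0 0 + x 1 1 = 1.
  by rewrite !inE => /orP[/orP[]|] /imsetP[c _ ->]; rewrite !mxE /=; ring.
rewrite /vertices idempotents_eq -setUA !card_setU_disjoint.
- by rewrite !cards1 c1 c2 c3 c5; nia.
- move=> x /set1P-> /set1P/mx2_inj[_ /eqP]; by rewrite (negPf o0).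
- move=> x /imsetP[[a b]]; rewrite !inE /= => b0 -> /imsetP[c _ /mx2_inj[_ /= e]].
  by rewrite e eqxx in b0.
- move=> x /setUP[] /imsetP[c].
    rewrite !inE => c0 -> /imsetP[c' _ /mx2_inj[_ e]].
    by rewrite e eqxx in c0.
  by move=> _ -> /imsetP[c' _ /mx2_inj[/eqP]]; rewrite (negPf o0).
- move=> x /set2P[] -> /imsetP[k]; rewrite inE => k0 /mx2_inj[/eqP];
  by rewrite eq_sym (negPf o0).
- move=> x /tr1 t1 xN; move: o0; rewrite -{}t1.
  case/setUP: xN => [/set2P[]|/imsetP[k _]] ->; rewrite !mxE /= ?addr0 ?subrr;
  by rewrite eqxx.
Qed.

End CardVertices.

(* Main.v *)
Require Import Defs.
From mathcomp Require Import all_boot all_order all_fingroup all_algebra.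
From mathcomp Require Import spectral sesquilinear complex ring lra zify.

(** Let P be the projective line over F, which has m = n + 2 points. A nonzero
    singular matrix is, up to a scalar, the pair (i, j) of its column line i and
    its kernel j; every pair is attained by exactly one vertex, and the product
    of (i, j) and (k, l) vanishes iff j = k. The idempotents are the pairs off
    the diagonal, the nilpotent vertices are the diagonal ones, and T is
    supported on the n diagonal pairs (i, i) with i neither 0 nor infinity.
    A vector indexed by the vertices is thus a table X on P x P, with row sums r
    and column sums c, and the quadratic form of T + A(H) is

      2 sum_i r_i c_i - sum_(i,j) X_ij X_ji + sum_(i in supp T) X_ii ^ 2

    (lemma [quad_TA]).

    This form splits along X = S + Y, with S symmetric of row sums s and Y
    skew-symmetric of row sums y, into
    2 |s|^2 - |S|^2 + sum_(supp T) S_ii^2 and |Y|^2 - 2 |y|^2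
    ([TA_form_split]). Expanding the square norm of m X_ij - (s_i + e s_j), where
    X_ji = e X_ij and e = 1 or -1, gives 2 |s|^2 <= m |S|^2 when the entries of S
    add up to 0, and 2 |y|^2 <= m |Y|^2 always, with the reverse inequalities
    when S_ij = u_i + u_j, respectively Y_ij = u_i - u_j. In particular A(H) alone
    has the eigenvalues 2m - 1 and m - 1 (on the tables u_i + u_j), -1
    (S with s = 0), 1 (Y with y = 0) and -(m - 1) (on the tables u_i - u_j); T only
    perturbs the symmetric part, upwards, by at most 1, and on a space of
    dimension n.

    The ordered eigenvalues are then located by the Courant-Fischer principle
    ([spectrum_ge], [spectrum_le]): if the form is at least c |X|^2 on the common
    kernel of k linear functionals, then at most k eigenvalues are below c, and
    symmetrically for upper bounds. All the subspaces above and their sums are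
    cut out by explicit families of linear equations, so that only equations have
    to be counted. With h = n (n + 1) / 2 this shows that the first n + 2
    eigenvalues lie between n + 1 and 2 n + 4, the next h equal 1, the next n lie
    between -1 and 0, and that they are followed by copies of -1 and by n + 1
    copies of -(n + 1). The ten assertions read off this list. *)

Set Implicit Arguments.
Unset Strict Implicit.
Unset Printing Implicit Defensive.

Import Order.TTheory GRing.Theory Num.Theory.
Local Open Scope ring_scope.

(** * Negative directions of a real symmetric matrix *)

Definition quad (R : comNzRingType) (m : nat) (M : 'M[R]_m) (x : 'rV[R]_m) : R :=
  \sum_i \sum_j x 0 i * M i j * x 0 j.

Section Spectrum.
Variable R : realType.
Implicit Types (m : nat) (s t : R).
Local Notation C := R[i].
Local Notation f := (real_complex R).
Local Notation reC := (@complex.Re R).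
Local Notation imC := (@complex.Im R).

Lemma quad_affine m (M : 'M[R]_m) s t x :
  quad (s *: M + t%:M) x = s * quad M x + t * \sum_i x 0 i ^+ 2.
Proof.
rewrite /quad !mulr_sumr -big_split; apply: eq_bigr => i _ /=.
rewrite mulr_sumr (bigD1 i) //= (bigD1 i (F := fun j => s * _)) //=.
rewrite !mxE eqxx mulr1n.
rewrite (eq_bigr (fun j => s * (x 0 i * M i j * x 0 j))); first by ring.
by move=> j ji; rewrite !mxE eq_sym (negPf ji) mulr0n; ring.
Qed.

(** The cross terms between real and imaginary parts are purely imaginary, so
    a complex vector on which a real form is negative has a real or an imaginary
    part on which it is negative. This is how the unitary diagonalisation over
    the complex numbers yields real vectors. *)
Lemma complex_quad m (M : 'M[R]_m) (u : 'rV[C]_m) :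
  reC (\sum_i \sum_j u 0 i * f (M i j) * (u 0 j)^*) =
  quad M (map_mx reC u) + quad M (map_mx imC u).
Proof.
rewrite raddf_sum -big_split; apply: eq_bigr => i _ /=.
rewrite raddf_sum -big_split; apply: eq_bigr => j _ /=.
rewrite !mxE; case: (u 0 i) => a b; case: (u 0 j) => c d /=.
by ring.
Qed.

Lemma spectrum_perm m (M : 'M[R]_m) alpha (sp : 'rV[C]_m) P :
  P \in unitmx -> map_mx f M = invmx P *m diag_mx sp *m P ->
  is_spectrum M alpha -> perm_eq [seq sp 0 i | i <- enum 'I_m] (map f alpha).
Proof.
move=> Pu eqB [_ eqM]; apply: prod_XsubC_eq; rewrite big_map big_enum big_map /=.
have -> : \prod_(a <- alpha) ('X - (f a)%:P) = char_poly (map_mx f M).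
  rewrite -map_char_poly eqM rmorph_prod; apply: eq_bigr => a _.
  by rewrite rmorphB /= map_polyX map_polyC.
have -> : char_poly (map_mx f M) = char_poly (diag_mx sp).
  rewrite /char_poly /char_poly_mx {1}eqB !map_mxM.
  have Pu' : map_mx polyC P \in unitmx by rewrite map_unitmx.
  rewrite map_invmx.
  set Q := map_mx _ P; set D := map_mx _ (diag_mx _).
  have -> : 'X%:M - invmx Q *m D *m Q = invmx Q *m ('X%:M - D) *m Q.
    by rewrite mulmxBr mulmxBl scalar_mxC mulmxKV.
  by rewrite !det_mulmx mulrC mulrA det_inv mulrV ?mul1r // -unitmxE.
rewrite char_poly_trig; last exact: diag_mx_is_trig.
by apply: eq_bigr => i _; rewrite mxE eqxx mulr1n.
Qed.

(** A combination of more than k eigenvectors can be chosen to satisfy k linear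
    equations. *)
Lemma exists_supported_kernel (K : fieldType) m k (J : {set 'I_m}) (A : 'M[K]_(m, k)) :
  (k < #|J|)%N -> exists z : 'rV[K]_m,
    [/\ z != 0, forall j, j \notin J -> z 0 j = 0 & z *m A = 0].
Proof.
move=> kJ; pose E : 'M[K]_(#|J|, m) := \matrix_(a, j) (enum_val a == j)%:R.
have : kermx (E *m A) != 0.
  by rewrite kermx_eq0 /row_free neq_ltn (leq_ltn_trans (rank_leq_col _)).
case/rowV0Pn=> w /sub_kermxP wK w0; exists (w *m E); split.
- apply: contraNneq w0 => wE; apply/eqP/rowP => a; rewrite mxE.
  move/rowP/(_ (enum_val a)): wE; rewrite !mxE (bigD1 a) //= mxE eqxx mulr1.
  rewrite big1 ?addr0 // => b ba; rewrite mxE.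
  by rewrite (inj_eq enum_val_inj) (negPf ba) mulr0.
- move=> j jJ; rewrite mxE big1 // => a _; rewrite mxE.
  case: eqP => [ej|]; last by rewrite mulr0.
  by rewrite -ej enum_valP in jJ.
- by rewrite -mulmxA.
Qed.

(** The dimension count behind the Courant-Fischer principle. The parameters s
    and t let a single statement serve for eigenvalues below c (s = 1, t = - c) and
    above c (s = -1, t = c). *)
Lemma negative_direction m (M : 'M[R]_m) alpha s t k (A : 'M[R]_(m, k)) :
  M^T = M -> is_spectrum M alpha ->
  (k < count (fun a => s * a + t < 0)%R alpha)%N ->
  exists2 x : 'rV[R]_m, x *m A = 0 & s * quad M x + t * \sum_i x 0 i ^+ 2 < 0.
Proof.
move=> symM spM kc; pose B : 'M[C]_m := map_mx f M.
have Bh : B \is hermsymmx.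
  apply/is_hermitianmxP; rewrite expr0 scale1r; apply/matrixP=> i j.
  by rewrite !mxE -[in RHS]symM mxE; exact/esym/conjc_real.
have /orthomx_spectralP := hermitian_normalmx Bh.
set P := spectralmx B; set sp := spectral_diag B => eqB.
have Pu : P \in unitmx by apply: spectral_unit.
have /unitarymxP PP : P \is unitarymx by apply: spectral_unitarymx.
have perm := spectrum_perm Pu eqB spM.
pose al i := reC (sp 0 i).
have alE i : sp 0 i = f (al i).
  have : sp 0 i \in map f alpha.
    by rewrite -(perm_mem perm); apply/mapP; exists i; rewrite ?mem_enum.
  by rewrite /al => /mapP[a _ ->].
pose J := [set i | s * al i + t < 0].
have cJ : #|J| = count (fun a => s * a + t < 0)%R alpha.
  have := perm_map reC perm; rewrite -!map_comp.
  rewrite (eq_map (g := id)) ?map_id // => /seq.permP/(_ (fun a => s * a + t < 0)) <-.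
  rewrite count_map cardE -size_filter; congr size.
  rewrite -(eq_filter (a1 := mem J)) => [|i]; last by rewrite !inE.
  by rewrite /enum_mem.
rewrite -cJ in kc.
(* z holds the coordinates of a vector u in the eigenbasis, where the form
   s M + t is diagonal and negative on the support J of z. *)
have [z [z0 zJ zK]] := exists_supported_kernel (P *m map_mx f A) kc.
pose u := z *m P; pose W := s *: M + t%:M.
have uW : \sum_i \sum_j u 0 i * f (W i j) * (u 0 j)^* =
    \sum_i f (s * al i + t) * `|z 0 i| ^+ 2.
  transitivity ((u *m map_mx f W *m u ^t*%sesqui) 0 0).
    rewrite exchange_big mxE; apply: eq_bigr => j _ /=.
    by rewrite !mxE -mulr_suml; congr (_ * _); apply: eq_bigr => i _; rewrite !mxE.
  have -> : map_mx f W = invmx P *m diag_mx (\row_i f (s * al i + t)) *m P.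
    have -> : diag_mx (\row_i f (s * al i + t)) = f s *: diag_mx sp + (f t)%:M.
      apply/matrixP=> i j; rewrite !mxE rmorphD rmorphM alE.
      by rewrite mulrnDl mulrnAr.
    rewrite map_mxD map_mxZ map_scalar_mx -/B {1}eqB mulmxDr mulmxDl.
    by rewrite -scalemxAr -scalemxAl scalar_mxC mulmxKV.
  rewrite /u trmx_mul map_mxM !mulmxA mulmxK //.
  rewrite -[_ *m P *m _]mulmxA PP mulmx1 !mxE; apply: eq_bigr => i _.
  rewrite mul_mx_diag !mxE [_ * f _]mulrC -mulrA; congr (_ * _).
  by rewrite normCK.
have neg : quad W (map_mx reC u) + quad W (map_mx imC u) < 0.
  rewrite -complex_quad uW.
  have z_real i : f (reC (`|z 0 i| ^+ 2)) = `|z 0 i| ^+ 2.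
    by rewrite RRe_real // realX // ger0_real.
  pose w i := reC (`|z 0 i| ^+ 2).
  have w_ge0 i : 0 <= w i by rewrite -lecR z_real exprn_ge0.
  have [j zj] : exists j, z 0 j != 0.
    apply/existsP; apply: contraNT z0 => /existsPn z0; apply/eqP/rowP => j.
    by rewrite mxE; apply/eqP; have := z0 j; rewrite negbK.
  have wj_gt0 : 0 < w j.
    rewrite lt_neqAle w_ge0 andbT eq_sym; apply: contraNneq zj => e.
    by have := z_real j; rewrite -/(w j) e => /esym/eqP; rewrite expf_eq0 normr_eq0.
  have -> : \sum_i f (s * al i + t) * `|z 0 i| ^+ 2 =
      f (\sum_i (s * al i + t) * w i).
    by rewrite rmorph_sum; apply: eq_bigr => i _; rewrite rmorphM -z_real.
  have jJ : j \in J by apply: contraNT zj => /zJ->.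
  rewrite /= (bigD1 j) //= ltr_wnDr //; last first.
    by rewrite pmulr_llt0 //; rewrite inE in jJ.
  apply: sumr_le0 => i _; have [iJ|/zJ zi0] := boolP (i \in J).
    by rewrite mulr_le0_ge0 // ltW //; rewrite inE in iJ.
  by rewrite /w zi0 normr0 expr0n /= mulr0.
have uA : u *m map_mx f A = 0 by rewrite /u -mulmxA.
have uA0 a : \sum_i u 0 i * f (A i a) = 0.
  move/rowP/(_ a): uA; rewrite !mxE => {2}<-.
  by apply: eq_bigr => i _; rewrite [map_mx _ _ _ _]mxE.
have reA : map_mx reC u *m A = 0.
  apply/rowP=> a; have /(congr1 reC) := uA0 a.
  rewrite raddf_sum !mxE => /= h; rewrite -[RHS]h.
  by apply: eq_bigr => i _; rewrite mxE; case: (u 0 i) => c d /=; ring.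
have imA : map_mx imC u *m A = 0.
  apply/rowP=> a; have /(congr1 imC) := uA0 a.
  rewrite raddf_sum !mxE => /= h; rewrite -[RHS]h.
  by apply: eq_bigr => i _; rewrite mxE; case: (u 0 i) => c d /=; ring.
rewrite !quad_affine in neg.
case: (ltP (s * quad M (map_mx reC u) +
  t * \sum_i map_mx reC u 0 i ^+ 2) 0) => re0; first by exists (map_mx reC u).
exists (map_mx imC u) => //; lra.
Qed.

End Spectrum.

(** * Eigenvalue bounds from forms on subspaces of small codimension *)

(** [W] contains a subspace of codimension at most [k]. Presenting the subspace
    by [k] linear equations, independent or not, replaces the computation of
    ranks by the counting of equations. *)
Definition codim_le (R : fieldType) (N : nat) (W : 'rV[R]_N -> Prop) (k : nat) :=
  exists A : 'M[R]_(N, k), forall x, x *m A = 0 -> W x.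

Section Codimension.
Variables (R : fieldType) (N : nat).
Implicit Types (W : 'rV[R]_N -> Prop) (k : nat).

Lemma codim_le_true : codim_le (fun _ : 'rV[R]_N => True) 0.
Proof. by exists 0. Qed.

Lemma codim_leI W1 W2 k1 k2 : codim_le W1 k1 -> codim_le W2 k2 ->
  codim_le (fun x => W1 x /\ W2 x) (k1 + k2).
Proof.
move=> [A1 W1A] [A2 W2A]; exists (row_mx A1 A2) => x.
rewrite mul_mx_row -row_mx0 => /eq_row_mx[xA1 xA2].
by split; [apply: W1A | apply: W2A].
Qed.

Lemma codim_le_sub W W' k : (forall x, W x -> W' x) -> codim_le W k -> codim_le W' k.
Proof. by move=> sub [A WA]; exists A => x /WA /sub. Qed.

Lemma codim_le_functionals (I : finType) (A : {set I}) (f : I -> 'rV[R]_N -> R) :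
  (forall t a x y, f t (a *: x + y) = a * f t x + f t y) ->
  codim_le (fun x => forall t, t \in A -> f t x = 0) #|A|.
Proof.
move=> f_lin; exists (\matrix_(i, s) f (enum_val s) (delta_mx 0 i)) => x xf t tA.
have fE : f t x = \sum_i x 0 i * f t (delta_mx 0 i).
  rewrite {1}[x]row_sum_delta.
  apply: (big_rec2 (fun u v => f t u = v)) => [|i y _ _ <-].
    by have := f_lin t (- 1) 0 0; rewrite scaler0 addr0 mulN1r addNr.
  by rewrite f_lin.
move/rowP/(_ (enum_rank_in tA t)): xf; rewrite [RHS]mxE mxE fE => h.
by rewrite -[RHS]h; apply: eq_bigr => i _; rewrite mxE enum_rankK_in.
Qed.

End Codimension.

Section SpectrumBounds.
Variables (R : realType) (N : nat) (M : 'M[R]_N) (alpha : seq R).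
Hypotheses (symM : M^T = M) (spM : is_spectrum M alpha).

Lemma size_spectrum : size alpha = N.
Proof.
by have := size_char_poly M; rewrite spM.2 size_prod_XsubC => -[].
Qed.

Lemma spectrum_noninc i j : (i <= j < N)%N -> nth 0 alpha j <= nth 0 alpha i.
Proof.
move=> /andP[ij jN]; have ge_trans : transitive (>=%R : rel R).
  by move=> y x z yx zy; apply: le_trans zy yx.
apply: (sorted_leq_nth ge_trans _ 0 spM.1) => //; first exact: lexx.
- by rewrite inE size_spectrum (leq_ltn_trans ij).
- by rewrite inE size_spectrum.
Qed.

(** Courant-Fischer: otherwise the i-th eigenvalue and all later ones, which are
    more than k, would be below c. *)
Lemma spectrum_ge W k c : codim_le W k ->
  (forall x, W x -> c * \sum_i x 0 i ^+ 2 <= quad M x) ->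
  forall i, (i + k < N)%N -> c <= nth 0 alpha i.
Proof.
move=> [A WA] cW i ikN; rewrite leNgt; apply/negP => lt_ac.
have [|x /WA/cW Wx] := negative_direction (s := 1) (t := - c) A symM spM.
  rewrite -[alpha](cat_take_drop i) count_cat.
  have : all (fun a => 1 * a - c < 0) (drop i alpha).
    apply/(all_nthP 0) => j; rewrite size_drop nth_drop size_spectrum => jN.
    have : nth 0 alpha (i + j) <= nth 0 alpha i by apply: spectrum_noninc; lia.
    lra.
  rewrite all_count => /eqP->; rewrite size_drop size_spectrum; lia.
lra.
Qed.

Lemma spectrum_le W k c : codim_le W k ->
  (forall x, W x -> quad M x <= c * \sum_i x 0 i ^+ 2) ->
  forall i, (k <= i < N)%N -> nth 0 alpha i <= c.
Proof.
move=> [A WA] cW i /andP[ki iN]; rewrite leNgt; apply/negP => lt_ac.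
have [|x /WA/cW Wx] := negative_direction (s := - 1) (t := c) A symM spM.
  rewrite -[alpha](cat_take_drop i.+1) count_cat.
  have : all (fun a => - 1 * a + c < 0) (take i.+1 alpha).
    apply/(all_nthP 0) => j; rewrite size_takel ?size_spectrum // => ji.
    rewrite nth_take //.
    have : nth 0 alpha i <= nth 0 alpha j by apply: spectrum_noninc; lia.
    lra.
  rewrite all_count => /eqP->; rewrite size_takel ?size_spectrum; lia.
lra.
Qed.

End SpectrumBounds.

(** * The quadratic form of T + A(H) on square tables *)

Section Forms.
Variables (R : realFieldType) (P : finType) (T : pred P).
Implicit Types (X : P -> P -> R) (u : P -> R).
Local Notation m := (#|P|%:R : R).

Definition rowsum X i := \sum_j X i j.
Definition colsum X j := \sum_i X i j.
Definition sqnorm X := \sum_i \sum_j X i j ^+ 2.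
Definition symp X i j := (X i j + X j i) / 2.
Definition skewp X i j := (X i j - X j i) / 2.
(** The diagonal sum is the contribution of T, the rest that of A(H): a table is
    a vector indexed by the vertices (see [quad_TA]). *)
Definition TA_form X :=
  2 * (\sum_i rowsum X i * colsum X i) - \sum_i \sum_j X i j * X j i +
  \sum_(i | T i) X i i ^+ 2.

Lemma rowsum_symp X i : rowsum (symp X) i = (rowsum X i + colsum X i) / 2.
Proof. by rewrite /rowsum /colsum -big_split mulr_suml. Qed.

Lemma rowsum_skewp X i : rowsum (skewp X) i = (rowsum X i - colsum X i) / 2.
Proof. by rewrite /rowsum /colsum -sumrB mulr_suml. Qed.

Lemma sqnorm_split X : sqnorm X = sqnorm (symp X) + sqnorm (skewp X).
Proof.
rewrite /sqnorm; have -> : \sum_i \sum_j X i j ^+ 2 =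
    \sum_i \sum_j (X i j ^+ 2 + X j i ^+ 2) / 2.
  rewrite -(eq_bigr _ (fun i _ => mulr_suml _ _ _ _)) -mulr_suml.
  rewrite (eq_bigr _ (fun i _ => big_split _ _ _ _ _)) big_split /=.
  by rewrite [X in _ + X]exchange_big /=; field.
rewrite -big_split; apply: eq_bigr => i _ /=; rewrite -big_split.
by apply: eq_bigr => j _ /=; rewrite /symp /skewp; field.
Qed.

(** With s and y the row sums of the two parts, r c = (s + y) (s - y) and
    X_ij X_ji = S_ij^2 - Y_ij^2: no mixed term survives. *)
Lemma TA_form_split X : TA_form X =
  (2 * (\sum_i rowsum (symp X) i ^+ 2) - sqnorm (symp X) +
     \sum_(i | T i) symp X i i ^+ 2) +
  (sqnorm (skewp X) - 2 * (\sum_i rowsum (skewp X) i ^+ 2)).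
Proof.
rewrite /TA_form.
have -> : \sum_i rowsum X i * colsum X i =
    \sum_i rowsum (symp X) i ^+ 2 - \sum_i rowsum (skewp X) i ^+ 2.
  rewrite -sumrB; apply: eq_bigr => i _.
  by rewrite rowsum_symp rowsum_skewp; field.
have -> : \sum_i \sum_j X i j * X j i = sqnorm (symp X) - sqnorm (skewp X).
  rewrite /sqnorm -sumrB; apply: eq_bigr => i _; rewrite -sumrB.
  by apply: eq_bigr => j _; rewrite /symp /skewp; field.
have -> : \sum_(i | T i) X i i ^+ 2 = \sum_(i | T i) symp X i i ^+ 2.
  by apply: eq_bigr => i _; rewrite /symp; field.
ring.
Qed.

Lemma sqnorm_ge0 X : 0 <= sqnorm X.
Proof. by apply: sumr_ge0 => i _; apply: sumr_ge0 => j _; exact: sqr_ge0. Qed.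

Lemma diag_ge0 X : 0 <= \sum_(i | T i) X i i ^+ 2.
Proof. by apply: sumr_ge0 => i _; exact: sqr_ge0. Qed.

Lemma diag_le_sqnorm X : \sum_(i | T i) X i i ^+ 2 <= sqnorm X.
Proof.
rewrite big_mkcond; apply: ler_sum => i _; rewrite (bigD1 i) //=.
have : 0 <= \sum_(j | j != i) X i j ^+ 2.
  by apply: sumr_ge0 => j _; exact: sqr_ge0.
case: (T i) => *; [exact: ler_wpDr|]; by rewrite addr_ge0 ?sqr_ge0.
Qed.

Lemma rowsums_ge0 X : 0 <= \sum_i rowsum X i ^+ 2.
Proof. by apply: sumr_ge0 => i _; exact: sqr_ge0. Qed.

Lemma sum_cst (c : R) : \sum_(i : P) c = m * c.
Proof. by rewrite sumr_const mulr_natl. Qed.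

Lemma sqr_sum_le (x : P -> R) : (\sum_i x i) ^+ 2 <= m * \sum_i x i ^+ 2.
Proof.
have [m0|m_gt0] := posnP #|P|.
  by rewrite !big_pred0 ?expr0n ?mulr0 // => i; have := card0_eq m0 i; rewrite inE.
have [s sE] : exists s, s = \sum_i x i by exists (\sum_i x i).
rewrite -sE.
have : 0 <= \sum_i (m * x i - s) ^+ 2
  by apply: sumr_ge0 => i _; exact: sqr_ge0.
have -> : \sum_i (m * x i - s) ^+ 2 =
    m ^+ 2 * (\sum_i x i ^+ 2) + (- 2 * m * s) * (\sum_i x i) + \sum_(i : P) s ^+ 2.
  rewrite !mulr_sumr -!big_split; apply: eq_bigr => i _ /=; ring.
rewrite sum_cst -sE.
have -> : m ^+ 2 * (\sum_i x i ^+ 2) + - 2 * m * s * s + m * s ^+ 2 =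
    m * (m * (\sum_i x i ^+ 2) - s ^+ 2) by ring.
by rewrite pmulr_rge0 ?ltr0n // subr_ge0.
Qed.

Lemma rowsums_le X : \sum_i rowsum X i ^+ 2 <= m * sqnorm X.
Proof. by rewrite mulr_sumr; apply: ler_sum => i _; exact: sqr_sum_le. Qed.

Section Parity.
Variables (X : P -> P -> R) (e : R).
Hypotheses (e1 : e ^+ 2 = 1) (Xe : forall i j, X j i = e * X i j).
Local Notation s := (rowsum X).

(** The table (s_i + e s_j) / m is the projection of X on the tables of the form
    u_i + e u_j when the s_i add up to 0; both inequalities below between |s|^2 and
    |X|^2 come from the norm of this residual. *)
Lemma sqnorm_residual :
  sqnorm (fun i j => m * X i j - (s i + e * s j)) =
  m ^+ 2 * sqnorm X - 2 * m * (\sum_i s i ^+ 2) + 2 * e * (\sum_i s i) ^+ 2.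
Proof.
have cross1 : \sum_i \sum_j X i j * s i = \sum_i s i ^+ 2.
  by apply: eq_bigr => i _; rewrite -mulr_suml expr2.
have cross2 : \sum_i \sum_j e * X i j * s j = \sum_i s i ^+ 2.
  rewrite exchange_big; apply: eq_bigr => j _ /=; rewrite -mulr_suml expr2.
  by congr (_ * _); apply: eq_bigr => i _; rewrite -Xe.
have cross3 : \sum_i \sum_j s i * s j = (\sum_i s i) ^+ 2.
  by rewrite expr2 mulr_suml; apply: eq_bigr => i _; rewrite mulr_sumr.
have rect1 : \sum_i \sum_(j : P) s i ^+ 2 = m * \sum_i s i ^+ 2.
  by rewrite mulr_sumr; apply: eq_bigr => i _; rewrite sum_cst.
have rect2 : \sum_(i : P) \sum_j s j ^+ 2 = m * \sum_i s i ^+ 2.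
  by rewrite exchange_big.
transitivity (m ^+ 2 * sqnorm X + (- 2 * m) * (\sum_i \sum_j X i j * s i)
  + (- 2 * m) * (\sum_i \sum_j e * X i j * s j)
  + \sum_i \sum_(j : P) s i ^+ 2 + \sum_(i : P) \sum_j s j ^+ 2
  + (2 * e) * (\sum_i \sum_j s i * s j)).
  rewrite !mulr_sumr -!big_split; apply: eq_bigr => i _ /=.
  rewrite !mulr_sumr -!big_split; apply: eq_bigr => j _ /=.
  have -> : s j ^+ 2 = e ^+ 2 * s j ^+ 2 by rewrite e1 mul1r.
  ring.
rewrite cross1 cross2 cross3 rect1 rect2; ring.
Qed.

(** The residual has nonnegative norm. The bound is twice as strong as the
    Cauchy-Schwarz bound [rowsums_le], and this factor is what makes -(n + 1) the
    exact lower end of the spectrum. *)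
Lemma centred_rowsums_le : \sum_i s i = 0 -> 2 * (\sum_i s i ^+ 2) <= m * sqnorm X.
Proof.
move=> s0; have [m0|m_gt0] := posnP #|P|.
  by rewrite big_pred0 ?m0 ?mulr0 ?mul0r // => i; have := card0_eq m0 i; rewrite inE.
have := sqnorm_ge0 (fun i j => m * X i j - (s i + e * s j)).
rewrite sqnorm_residual s0.
set a := sqnorm X; set b := \sum_i _.
have -> : m ^+ 2 * a - 2 * m * b + 2 * e * 0 ^+ 2 = m * (m * a - 2 * b) by ring.
by rewrite pmulr_rge0 ?ltr0n // subr_ge0.
Qed.

(** Here the residual is the constant (1 + e) (sum_i u_i), up to sign, whose norm
    can be compared exactly; it vanishes when e = -1. *)
Lemma rowsums_ge_of_potential (u : P -> R) : (forall i j, X i j = u i + e * u j) ->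
  m * sqnorm X <= 2 * (\sum_i s i ^+ 2).
Proof.
move=> Xu; have [m0|m_gt0] := posnP #|P|.
  by rewrite big_pred0 ?m0 ?mulr0 ?mul0r // => i; have := card0_eq m0 i; rewrite inE.
set c := \sum_i u i.
have sE i : s i = m * u i + e * c.
  rewrite /rowsum (eq_bigr _ (fun j _ => Xu i j)) big_split /= sum_cst.
  by rewrite mulr_sumr.
have ssum : \sum_i s i = (1 + e) * m * c.
  rewrite (eq_bigr _ (fun i _ => sE i)) big_split /= -mulr_sumr -/c sum_cst.
  by ring.
have := sqnorm_residual; rewrite ssum.
have -> : sqnorm (fun i j => m * X i j - (s i + e * s j)) = (m * (1 + e) * c) ^+ 2.
  rewrite /sqnorm (eq_bigr (fun=> \sum_(j : P) ((1 + e) * c) ^+ 2)) => [|i _].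
    by rewrite !sum_cst; ring.
  apply: eq_bigr => j _; rewrite !sE Xu -sqrrN; congr (_ ^+ 2).
  have -> : (1 + e) * c = (e + e ^+ 2) * c by rewrite e1 addrC.
  by ring.
set a := sqnorm X; set b := \sum_i _ => eq_ab.
have : m * (m * a - 2 * b) = - (m * (1 + e) * c) ^+ 2.
  have e3 : e * (1 + e) ^+ 2 = (1 + e) ^+ 2.
    have -> : e * (1 + e) ^+ 2 = e + e * e ^+ 2 + 2 * e ^+ 2 by ring.
    have -> : (1 + e) ^+ 2 = 1 + 2 * e + e ^+ 2 by ring.
    by rewrite e1; ring.
  have : (m * (1 + e) * c) ^+ 2 =
      m ^+ 2 * a - 2 * m * b + 2 * (e * (1 + e) ^+ 2) * m ^+ 2 * c ^+ 2.
    by rewrite eq_ab; ring.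
  rewrite e3 => eq2; transitivity (m ^+ 2 * a - 2 * m * b); first ring.
  lra.
move=> h; rewrite -subr_le0 -(pmulr_rle0 (x := m)) ?ltr0n // h oppr_le0.
exact: sqr_ge0.
Qed.

End Parity.

Lemma symp_sym X i j : symp X j i = 1 * symp X i j.
Proof. by rewrite mul1r /symp addrC. Qed.

Lemma skewp_skew X i j : skewp X j i = - 1 * skewp X i j.
Proof. by rewrite mulN1r /skewp -mulNr opprB. Qed.

Lemma sum_rowsum_skewp X : \sum_i rowsum (skewp X) i = 0.
Proof.
under eq_bigr do rewrite rowsum_skewp.
by rewrite -mulr_suml sumrB [X in _ - X]exchange_big subrr mul0r.
Qed.

Lemma sum_rowsum_symp X : \sum_i rowsum (symp X) i = \sum_i \sum_j X i j.
Proof.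
under eq_bigr do rewrite rowsum_symp.
rewrite -mulr_suml big_split /= [X in _ + X]exchange_big /=.
by rewrite /rowsum; field.
Qed.

Lemma skewp_rowsums_le X :
  2 * (\sum_i rowsum (skewp X) i ^+ 2) <= m * sqnorm (skewp X).
Proof.
apply: (@centred_rowsums_le _ (- 1)); rewrite ?sqrrN ?expr1n //.
  exact: skewp_skew.
exact: sum_rowsum_skewp.
Qed.

Lemma skewp_potential_rowsums_ge X u : (forall i j, skewp X i j = u i - u j) ->
  m * sqnorm (skewp X) <= 2 * (\sum_i rowsum (skewp X) i ^+ 2).
Proof.
move=> Xu; apply: (@rowsums_ge_of_potential _ (- 1) _ _ u); rewrite ?sqrrN ?expr1n //.
  exact: skewp_skew.
by move=> i j; rewrite mulN1r.
Qed.

Lemma symp_potential_rowsums_ge X u : (forall i j, symp X i j = u i + u j) ->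
  m * sqnorm (symp X) <= 2 * (\sum_i rowsum (symp X) i ^+ 2).
Proof.
move=> Xu; apply: (@rowsums_ge_of_potential _ 1 _ _ u); rewrite ?expr1n //.
  exact: symp_sym.
by move=> i j; rewrite mul1r.
Qed.

Lemma sqnorm_eq0 X : (forall i j, X i j = 0) -> sqnorm X = 0.
Proof.
by move=> X0; rewrite /sqnorm big1 // => i _; rewrite big1 // => j _; rewrite X0 expr0n.
Qed.

Lemma rowsums_eq0 X : (forall i, rowsum X i = 0) -> \sum_i rowsum X i ^+ 2 = 0.
Proof. by move=> X0; rewrite big1 // => i _; rewrite X0 expr0n. Qed.

Lemma diag_eq0 X : (forall i, T i -> X i i = 0) -> \sum_(i | T i) X i i ^+ 2 = 0.
Proof. by move=> X0; rewrite big1 // => i Ti; rewrite X0 // expr0n. Qed.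

Lemma diag_symp X i : symp X i i = X i i.
Proof. by rewrite /symp; field. Qed.

(** The bounds on the form below are the Rayleigh estimates for the successive
    groups of eigenvalues; m = n + 2, so that m - 1 = n + 1 and 2 m = 2 n + 4. *)
Section Bounds.
Variable X : P -> P -> R.
Hypothesis m_ge2 : 2 <= m.
Local Notation S := (symp X).
Local Notation Y := (skewp X).

Lemma part_bounds :
  [/\ 0 <= sqnorm S /\ 0 <= sqnorm Y,
      0 <= (m - 2) * sqnorm S /\ 0 <= (m - 2) * sqnorm Y,
      0 <= \sum_(i | T i) S i i ^+ 2 <= sqnorm S,
      0 <= \sum_i rowsum S i ^+ 2 <= m * sqnorm S &
      0 <= \sum_i rowsum Y i ^+ 2 /\ 2 * (\sum_i rowsum Y i ^+ 2) <= m * sqnorm Y].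
Proof.
have m2 : 0 <= m - 2 by rewrite subr_ge0.
by rewrite !mulr_ge0 ?sqnorm_ge0 ?diag_ge0 ?diag_le_sqnorm ?rowsums_ge0 ?rowsums_le
  ?skewp_rowsums_le.
Qed.

Lemma TA_form_ge : - (m - 1) * sqnorm X <= TA_form X.
Proof. rewrite TA_form_split (sqnorm_split X);
  case: part_bounds => -[? ?] [? ?] /andP[? ?] /andP[? ?] [? ?]; lra.
Qed.

Lemma TA_form_ge_skew0 : (forall i, rowsum Y i = 0) -> - 1 * sqnorm X <= TA_form X.
Proof. by move=> /rowsums_eq0 rY; rewrite TA_form_split (sqnorm_split X) rY;
  case: part_bounds => -[? ?] [? ?] /andP[? ?] /andP[? ?] [? ?]; lra.
Qed.

Lemma TA_form_ge_sym_potential u : (forall i j, S i j = u i + u j) ->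
  (forall i, rowsum Y i = 0) -> 1 * sqnorm X <= TA_form X.
Proof.
move=> /symp_potential_rowsums_ge Su /rowsums_eq0 rY.
by rewrite TA_form_split (sqnorm_split X) rY;
  case: part_bounds => -[? ?] [? ?] /andP[? ?] /andP[? ?] [? ?]; lra.
Qed.

Lemma TA_form_ge_only_sym_potential u : (forall i j, S i j = u i + u j) ->
  (forall i j, Y i j = 0) -> (m - 1) * sqnorm X <= TA_form X.
Proof.
move=> /symp_potential_rowsums_ge Su Y0.
have rY : \sum_i rowsum Y i ^+ 2 = 0.
  by apply: rowsums_eq0 => i; rewrite /rowsum big1.
by rewrite TA_form_split (sqnorm_split X) rY (sqnorm_eq0 Y0);
  case: part_bounds => -[? ?] [? ?] /andP[? ?] /andP[? ?] [? ?]; lra.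
Qed.

Lemma TA_form_le : TA_form X <= (2 * m) * sqnorm X.
Proof. rewrite TA_form_split (sqnorm_split X);
  case: part_bounds => -[? ?] [? ?] /andP[? ?] /andP[? ?] [? ?];
  lra.
Qed.

Lemma TA_form_le_centred : \sum_i \sum_j X i j = 0 -> TA_form X <= m * sqnorm X.
Proof.
rewrite -sum_rowsum_symp => /(centred_rowsums_le (expr1n _ 2) (symp_sym X)) rS.
rewrite TA_form_split (sqnorm_split X);
  case: part_bounds => -[? ?] [? ?] /andP[? ?] /andP[? ?] [? ?]; lra.
Qed.

Lemma TA_form_le_centred_diag0 : \sum_i \sum_j X i j = 0 -> (forall i, T i -> X i i = 0) ->
  TA_form X <= (m - 1) * sqnorm X.
Proof.
rewrite -sum_rowsum_symp => /(centred_rowsums_le (expr1n _ 2) (symp_sym X)) rS XT.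
have dS : \sum_(i | T i) S i i ^+ 2 = 0 by apply: diag_eq0 => i; rewrite diag_symp => /XT.
rewrite TA_form_split (sqnorm_split X) dS;
  case: part_bounds => -[? ?] [? ?] /andP[? ?] /andP[? ?] [? ?]; lra.
Qed.

Lemma TA_form_le_sym0 : (forall i, rowsum S i = 0) -> TA_form X <= 1 * sqnorm X.
Proof. by move=> /rowsums_eq0 rS; rewrite TA_form_split (sqnorm_split X) rS;
  case: part_bounds => -[? ?] [? ?] /andP[? ?] /andP[? ?] [? ?]; lra.
Qed.

Lemma TA_form_le_skew_potential u : (forall i, rowsum S i = 0) ->
  (forall i j, Y i j = u i - u j) -> TA_form X <= 0 * sqnorm X.
Proof.
move=> /rowsums_eq0 rS /skewp_potential_rowsums_ge rY.
by rewrite TA_form_split (sqnorm_split X) rS;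
  case: part_bounds => -[? ?] [? ?] /andP[? ?] /andP[? ?] [? ?]; lra.
Qed.

Lemma TA_form_le_skew_potential_diag0 u : (forall i, rowsum S i = 0) ->
  (forall i, T i -> X i i = 0) ->
  (forall i j, Y i j = u i - u j) -> TA_form X <= - 1 * sqnorm X.
Proof.
move=> /rowsums_eq0 rS XT /skewp_potential_rowsums_ge rY.
have dS : \sum_(i | T i) S i i ^+ 2 = 0 by apply: diag_eq0 => i; rewrite diag_symp => /XT.
by rewrite TA_form_split (sqnorm_split X) rS dS;
  case: part_bounds => -[? ?] [? ?] /andP[? ?] /andP[? ?] [? ?]; lra.
Qed.

Lemma TA_form_le_only_skew_potential u : (forall i j, S i j = 0) ->
  (forall i j, Y i j = u i - u j) -> TA_form X <= - (m - 1) * sqnorm X.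
Proof.
move=> S0 /skewp_potential_rowsums_ge rY.
have rS : \sum_i rowsum S i ^+ 2 = 0.
  by apply: rowsums_eq0 => i; rewrite /rowsum big1.
have dS : \sum_(i | T i) S i i ^+ 2 = 0 by apply: diag_eq0.
by rewrite TA_form_split (sqnorm_split X) rS dS (sqnorm_eq0 S0);
  case: part_bounds => -[? ?] [? ?] /andP[? ?] /andP[? ?] [? ?]; lra.
Qed.

End Bounds.

End Forms.

(** * Codimension of the conditions on tables *)

Section OrderedPairs.
Variable P : finType.
Implicit Types (A : {set P}) (i j : P).

(** An arbitrary total order on the points, which serves to list each unordered
    pair once when equations are counted. *)
Definition precedes i j := (enum_rank i < enum_rank j)%N.

Definition ordered_pairs A :=
  [set p : P * P | [&& p.1 \in A, p.2 \in A & precedes p.1 p.2]].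

(** A x A is the disjoint union of the pairs in increasing order, of their
    mirror images and of the diagonal. *)
Lemma card_ordered_pairs A : (2 * #|ordered_pairs A| + #|A| = #|A| * #|A|)%N.
Proof.
pose swap (p : P * P) := (p.2, p.1).
have swapK : involutive swap by case.
have card_gt : #|swap @: ordered_pairs A| = #|ordered_pairs A|.
  by rewrite card_imset //; apply: inv_inj.
have card_diag : #|[set (i, i) | i in A]| = #|A| by rewrite card_imset // => i j [].
have -> : (#|A| * #|A|)%N =
    #|ordered_pairs A :|: swap @: ordered_pairs A :|: [set (i, i) | i in A]|.
  rewrite -cardsX; apply: eq_card => -[i j]; rewrite !inE /=.
  have -> : ((i, j) \in swap @: ordered_pairs A) = ((j, i) \in ordered_pairs A).
    by rewrite -[(i, j)]/(swap (j, i)) mem_imset //; apply: inv_inj.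
  have -> : ((i, j) \in [set (i, i) | i in A]) = (i \in A) && (i == j).
    apply/imsetP/andP => [[k kA [-> ->]]|[iA /eqP <-]]; first by rewrite eqxx.
    by exists i.
  rewrite !inE /= /precedes -(inj_eq enum_rank_inj) -val_eqE /=.
  case: ltngtP => [_|_|/val_inj/enum_rank_inj <-]; rewrite ?andbT ?andbF ?orbF //=.
  - by rewrite andbC.
  - by rewrite andbb.
rewrite !card_setU_disjoint ?card_gt ?card_diag; first by lia.
- move=> p pA /imsetP[q]; move: pA; rewrite !inE /precedes.
  by move=> /and3P[_ _ h1] /and3P[_ _ h2] e; move: h1; rewrite e /= ltnNge ltnW.
- move=> p pO /imsetP[i _ e]; move: pO; rewrite {}e => /setUP[|/imsetP[[k l] + [ik il]]].
    by rewrite inE /precedes /= ltnn !andbF.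
  by rewrite inE /precedes /= -ik -il ltnn !andbF.
Qed.

Lemma ordered_pairs_ind A (Q : P -> P -> Prop) :
  (forall i, i \in A -> Q i i) -> (forall i j, Q i j -> Q j i) ->
  (forall p, p \in ordered_pairs A -> Q p.1 p.2) ->
  forall i j, i \in A -> j \in A -> Q i j.
Proof.
move=> Qr Qs Qlt i j iA jA.
case: (ltngtP (enum_rank i) (enum_rank j)) => [ij|ji|/val_inj/enum_rank_inj <-].
- by apply: (Qlt (i, j)); rewrite inE iA jA.
- by apply/Qs/(Qlt (j, i)); rewrite inE iA jA.
- exact: Qr.
Qed.

End OrderedPairs.

Section Conditions.
Variables (R : realFieldType) (P : finType) (N : nat) (psi : P * P -> 'I_N).
Implicit Types (x : 'rV[R]_N) (i j : P).

Definition table x i j : R := x 0 (psi (i, j)).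

Lemma table_lin a x y i j : table (a *: x + y) i j = a * table x i j + table y i j.
Proof. by rewrite /table !mxE. Qed.

Lemma symp_lin a x y i j :
  symp (table (a *: x + y)) i j = a * symp (table x) i j + symp (table y) i j.
Proof. by rewrite /symp !table_lin; field. Qed.

Lemma skewp_lin a x y i j :
  skewp (table (a *: x + y)) i j = a * skewp (table x) i j + skewp (table y) i j.
Proof. by rewrite /skewp !table_lin; field. Qed.

Lemma sum_lin (f : 'rV[R]_N -> P -> R) a x y :
  (forall i, f (a *: x + y) i = a * f x i + f y i) ->
  \sum_i f (a *: x + y) i = a * (\sum_i f x i) + \sum_i f y i.
Proof. by move=> f_lin; rewrite (eq_bigr _ (fun i _ => f_lin i)) big_split mulr_sumr. Qed.

Lemma codim_diag0 (T : {set P}) :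
  codim_le (fun x => forall i, i \in T -> table x i i = 0) #|T|.
Proof.
apply: (@codim_le_functionals _ _ _ _ (fun i x => table x i i)) => *.
exact: table_lin.
Qed.

Lemma codim_centred : codim_le (fun x => \sum_i \sum_j table x i j = 0) 1.
Proof.
have : codim_le (fun x => forall t, t \in [set tt] ->
    \sum_i \sum_j table x i j = 0) #|[set tt]|.
  apply: (@codim_le_functionals _ _ _ _ (fun _ x => \sum_i \sum_j table x i j)) => _ a x y.
  apply: (@sum_lin (fun x i => \sum_j table x i j)) => i.
  by apply: (@sum_lin (fun x => table x i)) => j; exact: table_lin.
by rewrite cards1; apply: codim_le_sub => x /(_ tt) -> //; rewrite inE.
Qed.

Lemma codim_sym_rowsum0 :
  codim_le (fun x => forall i, rowsum (symp (table x)) i = 0) #|P|.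
Proof.
rewrite -cardsT.
apply: (codim_le_sub (W := fun x => forall i, i \in setT ->
  rowsum (symp (table x)) i = 0)) => [x + i|]; first by apply; rewrite inE.
apply: (@codim_le_functionals _ _ _ _ (fun i x => rowsum (symp (table x)) i)) => i a x y.
by apply: (@sum_lin (fun x => symp (table x) i)) => j; exact: symp_lin.
Qed.

(** The row sums of a skew-symmetric table add up to 0, so the equation of one
    point [b] follows from the others. *)
Lemma codim_skew_rowsum0 (b : P) :
  codim_le (fun x => forall i, rowsum (skewp (table x)) i = 0) #|[set~ b]|.
Proof.
apply: (codim_le_sub (W := fun x => forall i, i \in [set~ b] ->
  rowsum (skewp (table x)) i = 0)) => [x xb i|]; last first.
  apply: (@codim_le_functionals _ _ _ _ (fun i x => rowsum (skewp (table x)) i)) => i a x y.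
  by apply: (@sum_lin (fun x => skewp (table x) i)) => j; exact: skewp_lin.
have [->|ib] := eqVneq i b; last by apply: xb; rewrite !inE.
have := sum_rowsum_skewp (table x); rewrite (bigD1 b) //= big1 ?addr0 // => j jb.
by apply: xb; rewrite !inE.
Qed.

(** The potential is the column of [b]; the equations with i or j equal to [b]
    then hold by skew symmetry. *)
Lemma codim_skew_potential (b : P) :
  codim_le (fun x => exists u, forall i j, skewp (table x) i j = u i - u j)
    #|ordered_pairs [set~ b]|.
Proof.
pose f (p : P * P) x := skewp (table x) p.1 p.2 -
  (skewp (table x) p.1 b - skewp (table x) p.2 b).
apply: (codim_le_sub (W := fun x => forall p, p \in ordered_pairs [set~ b] -> f p x = 0));
  last first.
  by apply: codim_le_functionals => p a x y; rewrite /f !skewp_lin; ring.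
move=> x xf; set Y := skewp (table x).
have Ys i j : Y j i = - Y i j by rewrite /Y skewp_skew mulN1r.
have Ybb : Y b b = 0 by rewrite /Y /skewp subrr mul0r.
exists (Y^~ b) => i j.
have [->|ib] := eqVneq i b; first by rewrite Ybb sub0r Ys.
have [->|jb] := eqVneq j b; first by rewrite Ybb subr0.
move: i j ib jb.
suff H : forall i j, i \in [set~ b] -> j \in [set~ b] ->
    Y i j = Y i b - Y j b.
  by move=> i j ib jb; apply: H; rewrite !inE.
apply: ordered_pairs_ind => [i _|i j e|p /xf /eqP].
- by rewrite subrr /Y /skewp subrr mul0r.
- by rewrite Ys e opprB.
- by rewrite subr_eq0 => /eqP.
Qed.

(** The diagonal forces the potential to be u_i = S_ii / 2. *)
Lemma codim_sym_potential :
  codim_le (fun x => exists u, forall i j, symp (table x) i j = u i + u j)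
    #|ordered_pairs [set: P]|.
Proof.
pose f (p : P * P) x := symp (table x) p.1 p.2 -
  (symp (table x) p.1 p.1 + symp (table x) p.2 p.2) / 2.
apply: (codim_le_sub (W := fun x => forall p, p \in ordered_pairs setT -> f p x = 0));
  last first.
  by apply: codim_le_functionals => p a x y; rewrite /f !symp_lin; ring.
move=> x xf; exists (fun i => symp (table x) i i / 2) => i j.
have Ss k l : symp (table x) l k = symp (table x) k l by rewrite symp_sym mul1r.
apply: (@ordered_pairs_ind _ setT (fun i j => symp (table x) i j =
  symp (table x) i i / 2 + symp (table x) j j / 2)); rewrite ?inE //.
- by move=> k _; field.
- by move=> k l e; rewrite Ss e addrC.
- by move=> p /xf /eqP; rewrite subr_eq0 => /eqP->; rewrite mulrDl.
Qed.

Lemma codim_skew0 :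
  codim_le (fun x => forall i j, skewp (table x) i j = 0) #|ordered_pairs [set: P]|.
Proof.
apply: (codim_le_sub (W := fun x => forall p, p \in ordered_pairs setT ->
  skewp (table x) p.1 p.2 = 0)) => [x xf i j|]; last first.
  by apply: (@codim_le_functionals _ _ _ _ (fun p x => skewp (table x) p.1 p.2)) => p a x y;
    exact: skewp_lin.
apply: (@ordered_pairs_ind _ setT (fun i j => skewp (table x) i j = 0)); rewrite ?inE //.
- by move=> k _; rewrite /skewp subrr mul0r.
- by move=> k l e; rewrite skewp_skew e mulr0.
Qed.

Lemma codim_sym0 :
  codim_le (fun x => forall i j, symp (table x) i j = 0)
    (#|ordered_pairs [set: P]| + #|[set: P]|).
Proof.
have codim_off : codim_le (fun x => forall p, p \in ordered_pairs setT ->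
    symp (table x) p.1 p.2 = 0) #|ordered_pairs [set: P]|.
  by apply: (@codim_le_functionals _ _ _ _ (fun p x => symp (table x) p.1 p.2)) => p a x y;
    exact: symp_lin.
apply: codim_le_sub (codim_leI codim_off (codim_diag0 setT)) => x [xo xd] i j.
apply: (@ordered_pairs_ind _ setT (fun i j => symp (table x) i j = 0)); rewrite ?inE //.
- by move=> k kP; rewrite diag_symp xd.
- by move=> k l e; rewrite symp_sym e mulr0.
Qed.

End Conditions.

(** * Vertices as pairs of points of the projective line *)

Section Coordinates.
Variable F : finFieldType.
Local Notation point := (option F).
Implicit Types (a b c l : F) (v w : F * F) (P Q : point) (p q : point * point).

(** The product of the column v, the scalar l and the row w. *)
Definition rank_one l v w : 'M[F]_2 :=
  mx2 (l * v.1 * w.1) (l * v.1 * w.2) (l * v.2 * w.1) (l * v.2 * w.2).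

Definition pairing w v := w.1 * v.1 + w.2 * v.2.

Lemma rank_one_mul l v w l' v' w' :
  rank_one l v w * rank_one l' v' w' = rank_one (l * l' * pairing w v') v w'.
Proof. by rewrite mul_mx2; congr mx2; rewrite /pairing /=; ring. Qed.

(** Points of the projective line: [Some a] is spanned by (a, 1) and [None], the
    point at infinity, by (1, 0). *)
Definition line_vec P : F * F := if P is Some a then (a, 1) else (1, 0).

(** A linear form with kernel the line of the point. *)
Definition line_form P : F * F := if P is Some a then (1, - a) else (0, 1).

Lemma pairing_eq0 P Q : (pairing (line_form Q) (line_vec P) == 0) = (Q == P).
Proof.
case: P Q => [a|] [b|]; rewrite /pairing /= ?(mul0r, mulr0, mul1r, mulr1, addr0, add0r);
  rewrite ?oner_eq0 ?eqxx //.
by rewrite subr_eq0 eq_sym.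
Qed.

Lemma rank_one_eq0 l P Q : (rank_one l (line_vec P) (line_form Q) == 0) = (l == 0).
Proof.
apply/eqP/eqP => [|->]; last by rewrite /rank_one !mul0r mx2_0.
by case: P Q => [a|] [b|]; rewrite -mx2_0 => /mx2_inj[/=]; rewrite ?mulr1.
Qed.

(** The scalar that turns a rank-one matrix into a vertex: off the diagonal it
    makes the trace 1, hence the matrix idempotent; on the diagonal it makes the
    matrix one of the chosen nilpotent representatives, N at infinity, M at 0 and
    N_(-b) at b. *)
Definition scaling p : F :=
  if p.1 != p.2 then (pairing (line_form p.2) (line_vec p.1))^-1
  else if p.1 is Some b then (if b == 0 then 1 else b^-1) else 1.

Lemma scaling_neq0 p : scaling p != 0.
Proof.
rewrite /scaling; have [e|ne] /= := eqVneq p.1 p.2; last first.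
  by rewrite invr_eq0 pairing_eq0 eq_sym.
case: p.1 => [b|]; rewrite ?oner_eq0 //.
by have [_|b0] := eqVneq b 0; rewrite ?oner_eq0 ?invr_eq0.
Qed.

Definition vertex p : 'M[F]_2 :=
  rank_one (scaling p) (line_vec p.1) (line_form p.2).

Lemma vertex_neq0 p : vertex p != 0.
Proof. by rewrite rank_one_eq0 scaling_neq0. Qed.

Lemma vertex_mul_eq0 p q : (vertex p * vertex q == 0) = (p.2 == q.1).
Proof.
rewrite rank_one_mul rank_one_eq0 !mulf_eq0 (negPf (scaling_neq0 p)).
by rewrite (negPf (scaling_neq0 q)) pairing_eq0.
Qed.

(** The column line and the kernel of a vertex are determined by the products
    with it that vanish. *)
Lemma vertex_inj : injective vertex.
Proof.
move=> p q e; have := vertex_mul_eq0 p (p.2, p.2); rewrite e vertex_mul_eq0 eqxx.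
have := vertex_mul_eq0 (p.1, p.1) p; rewrite e vertex_mul_eq0 eqxx.
by case: p q {e} => [a b] [c d] /= /eqP-> /eqP->.
Qed.

Lemma vertex_nilNk a : a != 0 -> vertex (Some a, Some a) = nilNk (- a).
Proof.
move=> a0; rewrite /vertex /scaling eqxx /= (negPf a0) /rank_one /nilNk /=.
by rewrite invrN opprK; congr mx2; field.
Qed.

Definition finite_nonzero P := if P is Some a then a != 0 else false.

Lemma vertex_nilNks p : (vertex p \in nilNks F) = (p.1 == p.2) && finite_nonzero p.1.
Proof.
apply/imsetP/andP => [[k]|].
  rewrite inE => k0; rewrite -[k]opprK -vertex_nilNk ?oppr_eq0 // => /vertex_inj->.
  by rewrite eqxx /= oppr_eq0.
case: p => -[a|] Q [/= /eqP <- a0] //; exists (- a); first by rewrite inE oppr_eq0.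
exact: vertex_nilNk.
Qed.

Lemma vertex_in p : vertex p \in vertices F.
Proof.
case: p => P Q; have [->|neqPQ] := eqVneq P Q; last first.
  rewrite !in_setU in_set; apply/orP; left; apply/orP; left; apply/andP; split.
    rewrite inE vertex_neq0; apply/existsP; exists (vertex (Q, Q)).
    by rewrite vertex_neq0 !vertex_mul_eq0 eqxx.
  rewrite rank_one_mul /vertex /scaling /= neqPQ /= mulrVK //.
  by rewrite unitfE pairing_eq0 eq_sym.
rewrite in_setU vertex_nilNks eqxx /=; case: Q => [a|] /=.
  have [->|a0] := eqVneq a 0; last by rewrite orbT.
  have -> : vertex (Some 0, Some 0) = nilM F.
    by rewrite /vertex /scaling /= !eqxx /rank_one /= oppr0 !(mulr0, mul0r, mulr1).
  by rewrite !inE eqxx !orbT.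
have -> : vertex (None, None) = nilN F.
  by rewrite /vertex /scaling /rank_one /= !(mulr0, mul0r, mulr1).
by rewrite !inE eqxx !orbT.
Qed.

Definition vertex_index p : 'I_#|vertices F| :=
  enum_rank_in (vertex_in (None, None)) (vertex p).

Lemma enum_val_vertex_index p : enum_val (vertex_index p) = vertex p.
Proof. by rewrite enum_rankK_in ?vertex_in. Qed.

Lemma vertex_index_inj : injective vertex_index.
Proof.
by move=> p q /(congr1 enum_val); rewrite !enum_val_vertex_index => /vertex_inj.
Qed.

(** There are as many vertices as pairs of points, so injectivity suffices. *)
Lemma vertex_index_bij : bijective vertex_index.
Proof.
apply: inj_card_bij; first exact: vertex_index_inj.
have Fgt0 : (0 < #|F|)%N by apply/card_gt0P; exists 0.
rewrite card_ord (card_vertices erefl) card_prod card_option.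
have -> : (#|F| - 1 + 2 = #|F|.+1)%N by lia.
by rewrite -mulnn.
Qed.

Lemma TA_vertex_index (R : nzRingType) p q :
  (Tmx F R + adjmx F R) (vertex_index p) (vertex_index q) =
  [&& p == q, p.1 == p.2 & finite_nonzero p.1]%:R +
  ((p.2 == q.1) || (q.2 == p.1))%:R.
Proof.
rewrite !mxE /adjH !enum_val_vertex_index !vertex_mul_eq0 vertex_nilNks.
by rewrite (inj_eq vertex_index_inj).
Qed.

End Coordinates.

Section QuadraticForm.
Variables (R : realFieldType) (P : finType) (T : pred P).

Lemma sum_indicator (f : P -> R) i : \sum_k (i == k)%:R * f k = f i.
Proof.
rewrite (bigD1 i) //= eqxx mul1r big1 ?addr0 // => k ki.
by rewrite eq_sym (negPf ki) mul0r.
Qed.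

(** Writing the indicator of (j = k or l = i) as the sum of the two indicators
    minus their product, the first two contribute row and column sums and the
    product contributes the transposition. *)
Lemma TA_form_as_double_sum (X : P -> P -> R) :
  \sum_(p : P * P) \sum_(q : P * P) X p.1 p.2 *
    ([&& p == q, p.1 == p.2 & T p.1]%:R + ((p.2 == q.1) || (q.2 == p.1))%:R) * X q.1 q.2
  = TA_form T X.
Proof.
rewrite -(pair_bigA _ (fun i j => \sum_(q : P * P) X i j *
    ([&& (i, j) == q, i == j & T i]%:R + ((j == q.1) || (q.2 == i))%:R) * X q.1 q.2)) /=.
have inner i j : \sum_(q : P * P) X i j *
    ([&& (i, j) == q, i == j & T i]%:R + ((j == q.1) || (q.2 == i))%:R) * X q.1 q.2 =
    X i j * rowsum X j + X i j * colsum X i - X i j * X j i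
    + ((i == j) && T i)%:R * X i j ^+ 2.
  rewrite -(pair_bigA _ (fun k l => X i j *
    ([&& (i, j) == (k, l), i == j & T i]%:R + ((j == k) || (l == i))%:R) * X k l)) /=.
  transitivity (X i j * (\sum_k (j == k)%:R * rowsum X k)
    + X i j * (\sum_k \sum_l (i == l)%:R * X k l)
    + (- X i j) * (\sum_k (j == k)%:R * (\sum_l (i == l)%:R * X k l))
    + (((i == j) && T i)%:R * X i j) * (\sum_k (i == k)%:R * (\sum_l (j == l)%:R * X k l))).
    rewrite !mulr_sumr -!big_split; apply: eq_bigr => k _ /=.
    rewrite !mulr_sumr -!big_split; apply: eq_bigr => l _ /=.
    rewrite xpair_eqE [l == i]eq_sym.
    by case: (i == k); case: (j == l); case: (j == k); case: (i == l);
       case: (_ && T i); rewrite /= ?mulr1n ?mulr0n; ring.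
  rewrite sum_indicator (eq_bigr (fun k => X k i)) => [|k _]; last exact: sum_indicator.
  rewrite !sum_indicator /colsum; ring.
under eq_bigr do under eq_bigr do rewrite inner.
under eq_bigr do rewrite !big_split sumrN /=.
rewrite !big_split sumrN /= /TA_form.
have -> : \sum_i \sum_j X i j * rowsum X j = \sum_i rowsum X i * colsum X i.
  by rewrite exchange_big; apply: eq_bigr => j _ /=; rewrite -mulr_suml mulrC.
have -> : \sum_i \sum_j X i j * colsum X i = \sum_i rowsum X i * colsum X i.
  by apply: eq_bigr => i _; rewrite -mulr_suml.
have -> : \sum_i \sum_j ((i == j) && T i)%:R * X i j ^+ 2 = \sum_(i | T i) X i i ^+ 2.
  rewrite [RHS]big_mkcond; apply: eq_bigr => i _.
  under eq_bigr do rewrite -mulnb natrM -mulrA.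
  by rewrite sum_indicator; case: (T i); rewrite ?mul1r ?mul0r.
ring.
Qed.

End QuadraticForm.

Section Transfer.
Variables (F : finFieldType) (R : realFieldType).
Local Notation M := (Tmx F R + adjmx F R).
Implicit Types x : 'rV[R]_#|vertices F|.

Definition vertex_table x := table (@vertex_index F) x.

Lemma quad_TA x : quad M x = TA_form (@finite_nonzero F) (vertex_table x).
Proof.
have bij := onW_bij _ (vertex_index_bij F).
rewrite -TA_form_as_double_sum /quad (reindex _ (bij _)) /=; apply: eq_bigr => p _.
rewrite (reindex _ (bij _)) /=; apply: eq_bigr => q _.
by rewrite TA_vertex_index /vertex_table /table -!surjective_pairing.
Qed.

Lemma sqnorm_vertex_table x : \sum_i x 0 i ^+ 2 = sqnorm (vertex_table x).
Proof.
rewrite (reindex _ (onW_bij _ (vertex_index_bij F))) /=.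
rewrite /sqnorm (pair_bigA _ (fun i j => vertex_table x i j ^+ 2)) /=.
by apply: eq_bigr => p _; rewrite /vertex_table /table -surjective_pairing.
Qed.

End Transfer.

(** * The eigenvalues of T + A(H) *)

Section Eigenvalues.
Variables (R : realType) (F : finFieldType) (n : nat) (alpha : seq R).
Hypothesis hn : n = (#|F| - 1)%N.
Hypothesis spM : is_spectrum (Tmx F R + adjmx F R) alpha.
Local Notation M := (Tmx F R + adjmx F R).
Local Notation N := ((n + 2) ^ 2)%N.
Local Notation h := ((n * (n + 1)) %/ 2)%N.
Local Notation a i := (nth 0 alpha i).
Local Notation T := (@finite_nonzero F).
Local Notation tab := (@vertex_table F R).

Lemma card_field : #|F| = n.+1.
Proof. by rewrite hn subn1 prednK //; apply/card_gt0P; exists 0. Qed.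

Lemma card_points : #|{: option F}| = (n + 2)%N.
Proof. by rewrite card_option card_field; lia. Qed.

Lemma card_finite_points : #|[set~ (None : option F)]| = (n + 1)%N.
Proof. by rewrite cardsC1 card_points; lia. Qed.

Lemma card_finite_nonzero : #|[set P | T P]| = n.
Proof.
have -> : [set P | T P] = Some @: [set~ (0 : F)].
  apply/setP => -[b|]; rewrite !inE /=; last by apply/esym/imsetP => -[].
  by rewrite mem_imset ?inE // => c d [].
by rewrite card_imset => [|c d []//]; rewrite cardsC1 card_field.
Qed.

Lemma double_half_pronic : (2 * h = n * (n + 1))%N.
Proof. by rewrite mulnC divnK // dvdn2 oddM oddD; case: (odd n). Qed.

Lemma card_pairs_finite_points : #|ordered_pairs [set~ (None : option F)]| = h.
Proof.
have := card_ordered_pairs [set~ (None : option F)]; have := double_half_pronic.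
rewrite card_finite_points; nia.
Qed.

Lemma card_pairs_points : #|ordered_pairs [set: option F]| = (h + n + 1)%N.
Proof.
have := card_ordered_pairs [set: option F]; have := double_half_pronic.
rewrite cardsT card_points; nia.
Qed.

Lemma points_ge2 : 2 <= #|{: option F}|%:R :> R.
Proof. by rewrite card_points ler_nat; lia. Qed.

(** The comment on each bound below names the space of tables on which the form
    is estimated; its codimension gives the range of indices. *)
Lemma eigenvalue_ge W k c (cW : codim_le W k)
  (H : forall x, W x -> c * sqnorm (tab x) <= TA_form T (tab x)) i :
  (i + k < N)%N -> c <= a i.
Proof.
move=> iN; apply: (spectrum_ge (symmetric_TA F R) spM cW).
  by move=> x /H; rewrite quad_TA sqnorm_vertex_table.
by rewrite (card_vertices hn).
Qed.

Lemma eigenvalue_le W k c (cW : codim_le W k)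
  (H : forall x, W x -> TA_form T (tab x) <= c * sqnorm (tab x)) i :
  (k <= i < N)%N -> a i <= c.
Proof.
move=> iN; apply: (spectrum_le (symmetric_TA F R) spM cW).
  by move=> x /H; rewrite quad_TA sqnorm_vertex_table.
by rewrite (card_vertices hn).
Qed.

Local Notation m := (#|{: option F}|%:R : R).
Local Notation psi := (@vertex_index F).

(** The tables u_i + u_j: two equations for each pair of points. *)
Lemma eigenvalue_ge_top i : (i < n + 2)%N -> m - 1 <= a i.
Proof.
move=> iN.
apply: (eigenvalue_ge (codim_leI (codim_sym_potential _ psi) (codim_skew0 _ psi))).
  by move=> x [[u Su] Y0]; apply: TA_form_ge_only_sym_potential points_ge2 u Su Y0.
by rewrite card_pairs_points; have := double_half_pronic; nia.
Qed.

(** The tables u_i + u_j plus the skew-symmetric tables with zero row sums. *)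
Lemma eigenvalue_ge_one i : (i < n + 2 + h)%N -> 1 <= a i.
Proof.
move=> iN.
apply: (eigenvalue_ge (codim_leI (codim_sym_potential _ psi)
  (codim_skew_rowsum0 _ psi None))).
  by move=> x [[u Su] Y0]; apply: TA_form_ge_sym_potential points_ge2 u Su Y0.
by rewrite card_pairs_points card_finite_points; have := double_half_pronic; nia.
Qed.

(** All tables whose skew part has zero row sums. *)
Lemma eigenvalue_ge_opp_one i : (i + (n + 1) < N)%N -> - 1 <= a i.
Proof.
move=> iN.
apply: (eigenvalue_ge (codim_skew_rowsum0 _ psi None)).
  by move=> x; apply: TA_form_ge_skew0 points_ge2.
by rewrite card_finite_points.
Qed.

Lemma eigenvalue_ge_bottom i : (i < N)%N -> - (m - 1) <= a i.
Proof.
move=> iN.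
apply: (eigenvalue_ge (codim_le_true _ _)); last by rewrite addn0.
by move=> x _; apply: TA_form_ge points_ge2.
Qed.

Lemma eigenvalue_le_top i : (i < N)%N -> a i <= 2 * m.
Proof.
move=> iN.
apply: (eigenvalue_le (codim_le_true _ _)) => //.
by move=> x _; apply: TA_form_le points_ge2.
Qed.

(** All tables whose entries add up to 0. *)
Lemma eigenvalue_le_second i : (1 <= i < N)%N -> a i <= m.
Proof.
move=> iN.
apply: (eigenvalue_le (codim_centred _ psi)) => //.
by move=> x; apply: TA_form_le_centred points_ge2.
Qed.

(** The tables whose entries add up to 0 and which vanish on the support of T:
    there the form is that of A(H). *)
Lemma eigenvalue_le_after_diag i : (n + 1 <= i < N)%N -> a i <= m - 1.
Proof.
move=> iN.
apply: (eigenvalue_le (codim_leI (codim_centred _ psi) (codim_diag0 _ psi [set P | T P]))).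
  move=> x [x0 xT]; apply: TA_form_le_centred_diag0 points_ge2 x0 _.
  by move=> i' iT; apply: xT; rewrite inE.
by rewrite card_finite_nonzero; lia.
Qed.

(** All tables whose symmetric part has zero row sums. *)
Lemma eigenvalue_le_one i : (n + 2 <= i < N)%N -> a i <= 1.
Proof.
move=> iN.
apply: (eigenvalue_le (codim_sym_rowsum0 _ psi)).
  by move=> x; apply: TA_form_le_sym0 points_ge2.
by rewrite card_points.
Qed.

(** The tables whose symmetric part has zero row sums and whose skew part is of
    the form u_i - u_j. *)
Lemma eigenvalue_le_zero i : (n + 2 + h <= i < N)%N -> a i <= 0.
Proof.
move=> iN.
apply: (eigenvalue_le (codim_leI (codim_sym_rowsum0 _ psi)
  (codim_skew_potential _ psi None))).
  by move=> x [S0 [u Yu]]; apply: TA_form_le_skew_potential points_ge2 u S0 Yu.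
by rewrite card_points card_pairs_finite_points.
Qed.

(** The tables of [eigenvalue_le_zero] that vanish on the support of T. *)
Lemma eigenvalue_le_opp_one i : (2 * n + 2 + h <= i < N)%N -> a i <= - 1.
Proof.
move=> iN.
apply: (eigenvalue_le (codim_leI (codim_leI (codim_sym_rowsum0 _ psi)
  (codim_skew_potential _ psi None)) (codim_diag0 _ psi [set P | T P]))).
  move=> x [[S0 [u Yu]] xT]; apply: TA_form_le_skew_potential_diag0 points_ge2 u S0 _ Yu.
  by move=> i' iT; apply: xT; rewrite inE.
by rewrite card_points card_pairs_finite_points card_finite_nonzero; lia.
Qed.

(** The tables u_i - u_j. *)
Lemma eigenvalue_le_bottom i : (N - (n + 1) <= i < N)%N -> a i <= - (m - 1).
Proof.
move=> iN.
apply: (eigenvalue_le (codim_leI (codim_sym0 _ psi) (codim_skew_potential _ psi None))).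
  by move=> x [S0 [u Yu]]; apply: TA_form_le_only_skew_potential points_ge2 u S0 Yu.
rewrite card_pairs_points card_pairs_finite_points cardsT card_points.
by have := double_half_pronic; nia.
Qed.

End Eigenvalues.

Theorem proposition3p6 (R : realType) (F : finFieldType) (n : nat)
    (hn : n = (#|F| - 1)%N) (alpha : seq R)
    (halpha : is_spectrum (Tmx F R + adjmx F R) alpha) :
  let a (i : nat) : R := nth 0 alpha (i - 1) in
  let h : nat := ((n * (n + 1)) %/ 2)%N in
  ((n + 1)%:R <= a 1%N <= (2 * n + 4)%:R) /\
  (forall i : nat, (2 <= i <= n + 1)%N ->
    (n + 1)%:R <= a i <= (n + 2)%:R) /\
  (1 <= a (n + 2)%N <= (n + 1)%:R) /\
  (forall i : nat, (n + 3 <= i <= 2 * n + 2)%N -> 1 <= a i <= 2) /\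
  (forall i : nat, (2 * n + 3 <= i <= n + 1 + h)%N -> a i = 1) /\
  (- 1 <= a (n + 2 + h)%N <= 1) /\
  (forall i : nat, (n + 3 + h <= i <= 2 * n + 3 + h)%N -> - 1 <= a i <= 0) /\
  (forall i : nat, (2 * n + 4 + h <= i <= (n + 2) ^ 2 - n - 1)%N ->
    a i = - 1) /\
  (forall i : nat, ((n + 2) ^ 2 - n <= i <= (n + 2) ^ 2 - 1)%N ->
    - (n + 1)%:R <= a i <= - n%:R) /\
  (a ((n + 2) ^ 2)%N = - (n + 1)%:R).
Proof.
move=> a h; have h2 : (2 * h = n * (n + 1))%N := double_half_pronic n.
have n_gt0 : (0 < n)%N by rewrite hn subn_gt0; exact: card_finNzRing_gt1.
have NE : ((n + 2) ^ 2 = n * n + 4 * n + 4)%N by rewrite -mulnn; nia.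
have nh : (n <= h)%N by nia.
have mE : #|{: option F}|%:R = (n + 2)%:R :> R by rewrite (card_points hn).
have lo1 i : (i < n + 2)%N -> (n + 1)%:R <= nth 0 alpha i.
  by move=> /(eigenvalue_ge_top hn halpha); rewrite mE !natrD; apply: le_trans; lra.
have lo2 i : (i < n + 2 + h)%N -> 1 <= nth 0 alpha i.
  exact: (@eigenvalue_ge_one R F n alpha hn halpha).
have lo3 i : (i + (n + 1) < (n + 2) ^ 2)%N -> - 1 <= nth 0 alpha i.
  exact: (@eigenvalue_ge_opp_one R F n alpha hn halpha).
have lo4 i : (i < (n + 2) ^ 2)%N -> - (n + 1)%:R <= nth 0 alpha i.
  by move=> /(eigenvalue_ge_bottom hn halpha); rewrite mE !natrD; apply: le_trans; lra.
have up1 i : (i < (n + 2) ^ 2)%N -> nth 0 alpha i <= (2 * n + 4)%:R.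
  move=> /(eigenvalue_le_top hn halpha); rewrite mE => /le_trans; apply.
  by rewrite -natrM ler_nat; lia.
have up2 i : (1 <= i < (n + 2) ^ 2)%N -> nth 0 alpha i <= (n + 2)%:R.
  by move=> /(eigenvalue_le_second hn halpha); rewrite mE.
have up3 i : (n + 1 <= i < (n + 2) ^ 2)%N -> nth 0 alpha i <= (n + 1)%:R.
  by move=> /(eigenvalue_le_after_diag hn halpha); rewrite mE => /le_trans; apply;
    rewrite !natrD; lra.
have up4 i : (n + 2 <= i < (n + 2) ^ 2)%N -> nth 0 alpha i <= 1.
  exact: (@eigenvalue_le_one R F n alpha hn halpha).
have up5 i : (n + 2 + h <= i < (n + 2) ^ 2)%N -> nth 0 alpha i <= 0.
  exact: (@eigenvalue_le_zero R F n alpha hn halpha).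
have up6 i : (2 * n + 2 + h <= i < (n + 2) ^ 2)%N -> nth 0 alpha i <= - 1.
  exact: (@eigenvalue_le_opp_one R F n alpha hn halpha).
have up7 i : ((n + 2) ^ 2 - (n + 1) <= i < (n + 2) ^ 2)%N -> nth 0 alpha i <= - (n + 1)%:R.
  by move=> /(eigenvalue_le_bottom hn halpha); rewrite mE => /le_trans; apply;
    rewrite !natrD; lra.
rewrite /a.
rewrite NE in lo3 lo4 up1 up2 up3 up4 up5 up6 up7 *.
have one2 : 1 <= 2 :> R by rewrite ler1n.
have nn1 : - (n + 1)%:R <= - n%:R :> R by rewrite lerN2 ler_nat; lia.
split; first by rewrite lo1 ?up1 //; lia.
split; first by move=> i hi; rewrite lo1 ?up2 //; lia.
split; first by rewrite lo2 ?up3 //; lia.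
split.
  by move=> i hi; rewrite lo2 ?(le_trans (up4 _ _) one2) //; lia.
split; first by move=> i hi; apply: le_anti; rewrite lo2 ?up4 //; lia.
split; first by rewrite lo3 ?up4 //; lia.
split; first by move=> i hi; rewrite lo3 ?up5 //; lia.
split; first by move=> i hi; apply: le_anti; rewrite lo3 ?up6 //; lia.
split; first by move=> i hi; rewrite lo4 ?(le_trans (up7 _ _) nn1) //; lia.
by apply: le_anti; rewrite lo4 ?up7 //; lia.
Qed.
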